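(* Suppose $B$ is a non-scattered totally imperfect separable metrizable space and let $\kappa=\max(\omega_1,|B|)$. Then: (1) $\max(\mathfrak{d},|B|)\le \mathrm{cof}(\mathcal{K}(B))\le \mathrm{cof}\big(([\kappa]^{<\omega})^{\omega}\big)$; and (2) if $\kappa=\aleph_n$ for some $n\in\omega$, then $\mathrm{cof}(\mathcal{K}(B))=\max(\mathfrak{d},|B|)$.
   Context: For a directed set $P$, $\mathrm{cof}(P)$ is the minimal size of a cofinal subset of $P$. $\mathfrak{d}=\mathrm{cof}(\omega^\omega)$, where $\omega^\omega$ has the coordinatewise order. For a space $X$, $\mathcal{K}(X)$ is the set of compact subsets of $X$ ordered by inclusion. $[\kappa]^{<\omega}$ is the set of finite subsets of $\kappa$ ordered by inclusion, and $([\kappa]^{<\omega})^\omega$ carries the coordinatewise order. A separable metrizable space is totally imperfect if it contains no homeomorphic copy of the Cantor set. A space $X$ is scattered if the transfinite process of successively removing isolated points (setting $X^{(0)}=X$, and $X^{(\alpha)}=X\setminus\bigcup_{\beta<\alpha}\{\text{isolated points of }X^{(\beta)}\}$) reaches $X^{(\alpha)}=\emptyset$ for some ordinal $\alpha$. *)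

(* Defs.v *)
(* MathComp-Analysis. *)
From mathcomp Require Import all_boot all_order all_algebra.
From mathcomp Require Import all_classical all_reals all_analysis.

Set Implicit Arguments.
Unset Strict Implicit.
Unset Printing Implicit Defensive.

Local Open Scope classical_set_scope.
Local Open Scope card_scope.
Local Open Scope ring_scope.

(* A cardinal is represented by any type (or set, coerced to a type) of that
   cardinality; cardinals are compared only through [#<=] and [#=].
   [least_card F] is a member of [F] of least cardinality: it exists as soon as
   [F] is nonempty, cardinals being well-ordered. *)
Definition least_card (T : Type) (F : set (set T)) : set T :=
  xget set0 [set A | F A /\ forall B, F B -> A #<= B].

Definition card_lt (T U : Type) (A : set T) (B : set U) : Prop :=
  A #<= B /\ ~ (B #<= A).

Definition card_max (T U : Type) : Type :=
  if [set: T] #<= [set: U] then U else T.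

(* The successor cardinal |T|^+, i.e., the least cardinal greater than |T|.
   As |T| < |set T|, it is realized by a subset of [set T]. *)
Definition succ_card (T : Type) : set (set T) :=
  least_card [set A : set (set T) | card_lt [set: T] A].
Arguments succ_card T : clear implicits.

Fixpoint aleph (n : nat) : Type :=
  if n is m.+1 then succ_card (aleph m) else nat.

Definition cofinal (P : Type) (le : P -> P -> Prop) (C : set P) : Prop :=
  forall x, exists2 y, C y & le x y.

Definition cof (P : Type) (le : P -> P -> Prop) : set P :=
  least_card (cofinal le).

Definition pointwise (P : Type) (le : P -> P -> Prop) (f g : nat -> P) : Prop :=
  forall n, le (f n) (g n).

Definition incl (T : Type) (S : set (set T)) (A B : S) : Prop :=
  set_val A `<=` set_val B.

Definition dominating_number : set (nat -> nat) :=
  cof (pointwise (fun m n : nat => (m <= n)%N)).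

Definition cof_compacts (T : topologicalType) :=
  cof (@incl T [set K | compact K]).
Arguments cof_compacts T : clear implicits.

Definition cof_finsets_omega (T : Type) :=
  cof (pointwise (@incl T [set A | finite_set A])).
Arguments cof_finsets_omega T : clear implicits.

Definition separable (T : topologicalType) : Prop :=
  exists2 S : set T, countable S & dense S.

(* The first four conditions are those of the factory [isMetric]. *)
Definition metrizable (R : realType) (T : topologicalType) : Prop :=
  exists d : T -> T -> R,
    [/\ forall x, d x x = 0,
        forall x y, d x y = 0 -> x = y,
        forall x y, d x y = d y x,
        forall y x z, d x z <= d x y + d y z
      & forall x, nbhs x = filter_from [set e : R | 0 < e]
                                       (fun e => [set y | d x y < e])].

(* Homeomorphism onto its range, endowed with the subspace topology. *)
Definition embedding (T U : topologicalType) (f : T -> U) : Prop :=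
  [/\ injective f,
      continuous f
    & forall O : set T, open O ->
        exists2 V : set U, open V & f @` O = V `&` range f].

Definition totally_imperfect (T : topologicalType) : Prop :=
  ~ exists f : cantor_space -> T, embedding f.

(* Ordinals are represented by the elements of a well-ordered type [W]; the
   recursion equation determines [X] uniquely. *)
Definition scattered (T : topologicalType) : Prop :=
  exists (W : Type) (le : rel W) (X : W -> set T),
    [/\ wochoice.well_order le,
        forall a, X a =
          [set: T] `\` \bigcup_(b in [set b | le b a /\ b <> a]) isolated (X b)
      & exists a, X a = set0].

(* Main.v *)
Require Import Defs.
From mathcomp Require Import all_boot all_order all_algebra.
From mathcomp Require Import all_classical all_reals all_analysis.
From mathcomp Require Import lra.

(** Compact subsets of [B] contain no Cantor set, so a nonempty crowded subset
    of [B] is never contained in a compact set. Hence a property of subsets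
    that passes to subsets and finite unions, and passes to [C] as soon as it
    holds for all [C \ ball(x, e)] with [x] a fixed point, holds for every
    compact [K]: the points of [K] at which it fails locally would be crowded.

    Applied to countability, this shows that compact sets are countable, so that
    [|B|] is at most [aleph_0] times [cof(K(B))]. As [B] is not scattered, some
    [x] has no compact neighborhood; each closed ball around [x] of radius
    [1/(n+1)] has an increasing open cover [U_(n,m)] without finite subcover,
    and sending [K] to the function giving for each [n] some [m] such that
    [U_(n,m)] contains the part of [K] in the ball takes cofinal sets
    to dominating ones.

    For the upper bound, fix an uncountable well-order [V] in [kappa] whose
    proper initial segments are countable. A family [f] of finite subsets of
    [kappa] indexed by finite sequences of naturals encodes a well-founded
    construction of a compact set [fan a f]: finitely many centers, and around
    each of them, within distance [1/n], finitely many [fan b _] with [b < a].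
    By the induction principle, every compact set is covered by a fan.

    For (2), countable subsets of [aleph_n] admit a cofinal family of size
    [aleph_n] by induction on [n], and the finite subsets of a countable set
    are controlled by a dominating family. *)

Set Implicit Arguments.
Unset Strict Implicit.
Unset Printing Implicit Defensive.
Import Order.TTheory GRing.Theory Num.Theory.

Local Open Scope classical_set_scope.
Local Open Scope card_scope.

(** * Cardinals *)

Lemma card_leTP (T U : Type) :
  [set: T] #<= [set: U] <-> exists f : T -> U, injective f.
Proof.
split=> [/card_leP[f]|[f finj]].
  exists (fun x => set_val (f (SigSub (mem_set (I : [set: T] x))))) => x y /val_inj.
  by move=> /(@inj _ _ _ f); rewrite !inE => /(_ I I) [].
apply/card_leP/injfunPex.
exists (fun x => SigSub (mem_set (I : [set: U] (f (set_val x))))) => //.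
by move=> x y _ _ [] /finj /val_inj.
Qed.

Lemma card_leSP (T U : Type) (A : set T) (B : set U) :
  A #<= B <-> exists f : A -> B, injective f.
Proof.
by rewrite -card_leTP (card_le_eql (card_setT A)) (card_le_eqr (card_setT B)).
Qed.

Lemma surj_card_leT (T U : Type) (g : U -> T) :
  (forall t, exists u, g u = t) -> [set: T] #<= [set: U].
Proof.
move=> /choice[h gh]; apply/card_leTP; exists h => x y hxy.
by rewrite -(gh x) hxy gh.
Qed.

Lemma card_leX (T T' U U' : Type) : [set: T] #<= [set: T'] ->
  [set: U] #<= [set: U'] -> [set: T * U] #<= [set: T' * U'].
Proof.
move=> /card_leTP[f fi] /card_leTP[g gi]; apply/card_leTP.
by exists (fun p => (f p.1, g p.2)) => -[a b] [c d] [/fi -> /gi ->].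
Qed.

(* Zorn's lemma yields a maximal family of choice functions that differ
   pairwise on every member of [F]; by maximality its values exhaust some
   member of [F], while it injects into all of them. *)
Lemma least_cardP (T : Type) (F : set (set T)) : F !=set0 ->
  F (least_card F) /\ forall B, F B -> least_card F #<= B.
Proof.
move=> [A0 FA0]; rewrite /least_card; apply: (@xgetPex _ set0
  [set A | F A /\ forall B, F B -> A #<= B]).
pose P (X : set (set T -> T)) := (forall c A, X c -> F A -> A (c A)) /\
  (forall c c' A, X c -> X c' -> F A -> c A = c' A -> c = c').
have [|X [[PX1 PX2] Xmax]] := @Zorn_bigcup _ P.
  move=> G GP tot; split=> [c A [X GX Xc]|c c' A [X GX Xc] [Y GY Yc]] FA.
    by have [h _] := GP _ GX; exact: h Xc FA.
  have [XY|YX] := tot _ _ GX GY.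
    by have [_ h] := GP _ GY; exact: h (XY _ Xc) Yc FA.
  by have [_ h] := GP _ GX; exact: h Xc (YX _ Yc) FA.
have [[A FA AX]|nA] :=
    pselect (exists2 A, F A & forall t, A t -> exists2 c, X c & c A = t).
  exists A; split=> // B FB; apply/card_leSP.
  have /choice[g gP] (a : A) : exists c, X c /\ c A = val a.
    by have [c ? ?] := AX _ (set_valP a); exists c.
  have gB (a : A) : B (g a B) by have [Xga _] := gP a; exact: PX1 Xga FB.
  exists (fun a => SigSub (mem_set (gB a))) => a a' [] gaa.
  apply/val_inj; have [Xa <-] := gP a; have [Xa' <-] := gP a'.
  by rewrite (PX2 _ _ _ Xa Xa' FB gaa).
have ex A : F A -> exists t, A t /\ forall c, X c -> c A <> t.
  move=> FA; apply: contrapT => nt; apply: nA; exists A => // t At.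
  apply: contrapT => nc; apply: nt; exists t; split=> // c Xc cA.
  by apply: nc; exists c.
have [t0 _] := ex _ FA0.
have /choice[c cP] (A : set T) :
    exists t, F A -> A t /\ forall c, X c -> c A <> t.
  have [/ex[t ?]|] := pselect (F A); last by exists t0.
  by exists t.
have [] := Xmax (X `|` [set c]).
  split=> [|/(_ c)]; first by move=> ? ?; left.
  by move=> /(_ (or_intror erefl)) Xc; have [_ /(_ _ Xc)] := cP _ FA0; exact.
split=> [c1 A [X1|->]|c1 c2 A [X1|->] [X2|->]] FA //.
- exact: PX1 X1 FA.
- exact: (cP _ FA).1.
- exact: PX2 X1 X2 FA.
- by move=> e; have [_ /(_ _ X1)] := cP _ FA.
- by move=> e; have [_ /(_ _ X2)] := cP _ FA; rewrite e.
Qed.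

(** [least_cardP] is applied to the pair formed by the disjoint copies of [T] and [U] in [T + U]:
    the least copy injects into the other. *)
Lemma card_le_total (T U : Type) : [set: T] #<= [set: U] \/ [set: U] #<= [set: T].
Proof.
pose A := range (inl : T -> T + U); pose B := range (inr : U -> T + U).
have eA : A #= [set: T] by apply: inj_card_eq => ? ? _ _ [].
have eB : B #= [set: U] by apply: inj_card_eq => ? ? _ _ [].
rewrite -(card_le_eql eA) -(card_le_eqr eB) -(card_le_eql eB) -(card_le_eqr eA).
have [|FC le] := @least_cardP _ [set A; B]; first by exists A; left.
by case: FC => e; rewrite e in le; [left|right]; apply: le; [right|left].
Qed.

Lemma card_maxP (T U V : Type) : [set: T] #<= [set: V] ->
  [set: U] #<= [set: V] -> [set: card_max T U] #<= [set: V].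
Proof. by rewrite /card_max; case: ifP. Qed.

Lemma card_le_maxl (T U : Type) : [set: T] #<= [set: card_max T U].
Proof. by rewrite /card_max; case: ifP => // _; exact: card_lexx. Qed.

Lemma card_le_maxr (T U : Type) : [set: U] #<= [set: card_max T U].
Proof.
by rewrite /card_max; case: ifP => [_|/negP nle]; [exact: card_lexx|];
  case: (card_le_total T U).
Qed.

(* [G] is the graph of an injection [A * A -> A], where [A] is the set of the
   [x] such that [(x, x)] is in its domain. *)
Definition sqdom (T : Type) (G : set ((T * T) * T)) x := exists t, G ((x, x), t).

Definition square_graph (T : Type) (G : set ((T * T) * T)) :=
  [/\ forall p t t', G (p, t) -> G (p, t') -> t = t',
      forall p p' t, G (p, t) -> G (p', t) -> p = p',
      forall x y, sqdom G x -> sqdom G y -> exists t, G ((x, y), t)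
    & forall x y t, G ((x, y), t) -> [/\ sqdom G x, sqdom G y & sqdom G t]].

Lemma square_graph_bigcup (T : Type) (F : set (set ((T * T) * T))) :
  (forall X, F X -> square_graph X) -> total_on F subset ->
  square_graph (\bigcup_(X in F) X).
Proof.
move=> FP tot.
have dir X Y : F X -> F Y -> exists2 Z, F Z & X `<=` Z /\ Y `<=` Z.
  by move=> FX FY; have [] := tot _ _ FX FY => ?; [exists Y => //|exists X => //]; split.
have sub X x : F X -> sqdom X x -> sqdom (\bigcup_(X in F) X) x.
  by move=> FX [t Xt]; exists t, X.
split.
- move=> p t t' [X FX Xt] [Y FY Yt].
  have [Z FZ [XZ YZ]] := dir _ _ FX FY; have [h _ _ _] := FP _ FZ.
  by apply: h (XZ _ Xt) (YZ _ Yt).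
- move=> p t t' [X FX Xt] [Y FY Yt].
  have [Z FZ [XZ YZ]] := dir _ _ FX FY; have [_ h _ _] := FP _ FZ.
  by apply: h (XZ _ Xt) (YZ _ Yt).
- move=> x y [t [X FX Xt]] [t' [Y FY Yt]].
  have [Z FZ [XZ YZ]] := dir _ _ FX FY; have [_ _ h _] := FP _ FZ.
  have [u Zu] := h x y (ex_intro _ t (XZ _ Xt)) (ex_intro _ t' (YZ _ Yt)).
  by exists u; exists Z.
- move=> x y t [X FX Xt]; have [_ _ _ h] := FP _ FX.
  by have [] := h _ _ _ Xt; split; apply: sub FX _.
Qed.

(** Let [A] be the domain of a maximal square graph above [G0]. If the complement of [A] injects
    into [A], then [T] injects into [A], and [A] absorbs its square. Otherwise [A] has a copy in its
    complement, which leaves room to enlarge the graph. *)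
Lemma card_le_square (T : Type) : infinite_set [set: T] ->
  [set: T * T] #<= [set: T].
Proof.
move=> /infiniteP /card_leTP[e einj].
pose G0 : set ((T * T) * T) :=
  [set ((e p.1, e p.2), e (choice.pickle p)) | p in [set: nat * nat]].
have G0dom i : sqdom G0 (e i).
  by exists (e (choice.pickle (i, i))); exists (i, i).
have domG0 x : sqdom G0 x -> exists i, x = e i.
  by move=> [t [[i j] _ [<- _ _]]]; exists i.
have G0P : square_graph G0.
  split.
  - move=> p t t' [[i j] _ [<- <-]] [[k l] _ [/einj <- /einj <- <-]].
    by [].
  - move=> p p' t [[i j] _ [<- <-]] [[k l] _ [<- /einj]].
    by move=> /(pcan_inj choice.pickleK) [-> ->].
  - move=> _ _ /domG0[i ->] /domG0[j ->].
    by exists (e (choice.pickle (i, j))); exists (i, j).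
  - by move=> x y t [[i j] _ [<- <- <-]]; split; exact: G0dom.
(* Adding [G0] after the union keeps the empty chain harmless and forces a copy of [nat] into the
   domain. *)
have [|G1 [G1P G1max]] := @Zorn_bigcup _ (fun G => square_graph (G `|` G0)).
  move=> F FP tot.
  have [[X FX]|nF] := pselect (F !=set0); last first.
    rewrite (_ : \bigcup_(X in F) X = set0) ?set0U// -subset0.
    by move=> p [X FX]; case: nF; exists X.
  rewrite (_ : _ `|` _ =
    \bigcup_(Y in [set Z `|` G0 | Z in F]) Y); last first.
    apply/seteqP; split=> [p [[Y FY Yp]|Gp]|p [_ [Y FY <-] [Yp|Gp]]].
    - by exists (Y `|` G0); [exists Y|left].
    - by exists (X `|` G0); [exists X|right].
    - by left; exists Y.
    - by right.
  apply: square_graph_bigcup => [_ [Y FY <-]|]; first exact: FP.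
  move=> _ _ [Y FY <-] [Z FZ <-].
  by have [] := tot _ _ FY FZ => s; [left|right]; exact: setSU.
set G := G1 `|` G0 in G1P; pose A : set T := sqdom G.
have [Gfun Ginj Gtot Gdom] := G1P.
have eA i : A (e i) by have [t Gt] := G0dom i; exists t; right.
have AA : [set: A * A] #<= [set: A].
  have /choice[f fP] (p : A * A) : exists t : A, G ((val p.1, val p.2), val t).
    have [t Gt] := Gtot _ _ (set_valP p.1) (set_valP p.2).
    have [_ _ At] := Gdom _ _ _ Gt.
    by exists (SigSub (mem_set At)).
  apply/card_leTP; exists f => -[a b] [c d] fe.
  have := fP (a, b); rewrite fe => h.
  by have [/val_inj -> /val_inj ->] := Ginj _ _ _ h (fP (c, d)).
have AbA : [set: A * bool] #<= [set: A].
  apply: card_le_trans AA; apply/card_leTP.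
  exists (fun p => (p.1, SigSub (mem_set (eA (nat_of_bool p.2))))).
  move=> -[a b] [c d] [-> /einj].
  by case: b; case: d.
have [lA|lA] := card_le_total (~` A) A.
  have TA : [set: T] #<= [set: A].
    apply: card_le_trans AbA; have /card_leTP[f finj] := lA.
    apply: (@surj_card_leT _ _ (fun p : A * bool => if p.2 then val p.1 else
      if pselect (exists x, f x = p.1) is left h then val (projT1 (cid h))
      else val p.1)) => t.
    have [At|nAt] := pselect (A t); first by exists (SigSub (mem_set At), true).
    pose u : ~` A := SigSub (mem_set (nAt : (~` A) t)).
    exists (f u, false) => /=.
    case: pselect => [h|[]]; last by exists u.
    by case: cid => x /= /finj ->.
  apply: card_le_trans (card_leX TA TA) _; apply: card_le_trans AA _.
  by rewrite (card_le_eql (card_setT A)); exact: card_leT.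
exfalso; have /card_leTP[j jinj] := lA.
pose A' : set T := [set t | exists a, t = val (j a)].
have A'A t : A' t -> ~ A t by move=> [a ->]; exact: (set_valP (j a)).
pose U := A `|` A'.
have UA : [set: U] #<= [set: A].
  apply: card_le_trans AbA.
  apply: (@surj_card_leT _ _ (fun p : A * bool => if p.2
    then SigSub (mem_set (or_introl (set_valP p.1) : U (val p.1)))
    else SigSub (mem_set (or_intror (ex_intro _ p.1 erefl) :
           U (val (j p.1)))))).
  move=> [t /[dup] /set_mem [At|[a ta]] Ut].
    by exists (SigSub (mem_set At), true); exact: val_inj.
  by exists (a, false); exact/val_inj.
have /card_leTP[k kinj] : [set: U * U] #<= [set: A].
  by apply: card_le_trans AA; exact: card_leX.
have inU t : U t -> exists u : U, val u = t by move=> Ut; exists (SigSub (mem_set Ut)).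
(* The pairs of [U] outside the domain of [G] get values in [A'], hence away from those of [G]; the
   injection [k] of [U * U] into [A] keeps them distinct. *)
pose G2 : set ((T * T) * T) := [set p | exists a b : U,
  [/\ p.1 = (val a, val b), ~ (A (val a) /\ A (val b)) & p.2 = val (j (k (a, b)))]].
have G2val p t : G2 (p, t) -> A' t by move=> [a [b [/= _ _ ->]]]; exists (k (a, b)).
have Gval p t : G (p, t) -> A t by case: p => x y /Gdom[].
have dU x : sqdom (G `|` G2) x <-> U x.
  split=> [[t [Gt|[a [b [/= [xa xb] _ _]]]]]|Ux].
  - by left; exists t.
  - by rewrite xa; exact: set_valP.
  have [[t Gt]|nAx] := pselect (A x); first by exists t; left.
  have [u ux] := inU _ Ux; exists (val (j (k (u, u)))); right.
  by exists u, u; rewrite ux; split => // -[].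
have G2P : square_graph (G `|` G2).
  split.
  - move=> p t t' [Gt|[a [b [/= -> nab ->]]]] [Gt'|[c [d [/= pcd ncd ->]]]].
    + exact: Gfun Gt Gt'.
    + by rewrite pcd in Gt; have [? ? _] := Gdom _ _ _ Gt; case: ncd.
    + by have [? ? _] := Gdom _ _ _ Gt'; case: nab.
    + by case: pcd => /val_inj -> /val_inj ->.
  - move=> p p' t [Gt|Gt] [Gt'|Gt'].
    + exact: Ginj Gt Gt'.
    + by have := A'A _ (G2val _ _ Gt'); case; exact: Gval Gt.
    + by have := A'A _ (G2val _ _ Gt); case; exact: Gval Gt'.
    + case: Gt Gt' => [a [b [/= -> _ ->]]] [c [d [/= -> _]]].
      by move=> /val_inj /jinj /kinj [-> ->].
  - move=> x y /dU Ux /dU Uy.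
    have [[Ax Ay]|nA] := pselect (A x /\ A y).
      by have [t ?] := Gtot _ _ Ax Ay; exists t; left.
    have [u ux] := inU _ Ux; have [v vy] := inU _ Uy.
    exists (val (j (k (u, v)))); right; exists u, v.
    by rewrite ux vy.
  - move=> x y t [Gt|G2t].
      by have [] := Gdom _ _ _ Gt; split; apply/dU; left.
    have ? := G2val _ _ G2t; case: G2t => a [b [/= [-> ->] _ _]].
    by split; apply/dU; [exact: set_valP|exact: set_valP|right].
apply: (G1max (G1 `|` G2)); last first.
  by rewrite setUAC.
split=> [p|sub]; first by left.
pose z := j (SigSub (mem_set (eA 0%N))).
have [t Gt] : sqdom (G `|` G2) (val z).
  by apply/dU; right; exists (SigSub (mem_set (eA 0%N))).
apply: (set_valP z); exists t; case: Gt => // G2t.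
by left; apply: sub; right.
Qed.

(** * Cantor's theorem, successor cardinals and alephs *)

Lemma not_card_le_set (T : Type) : ~ ([set: set T] #<= [set: T]).
Proof.
move=> /card_leTP[f finj].
pose D := [set t | exists A, f A = t /\ ~ A t].
have [|nD] := pselect (D (f D)); last by apply: (nD); exists D; split.
by move=> /[dup] DfD [A [/finj ->]].
Qed.

Lemma succ_cardP (T : Type) : card_lt [set: T] (succ_card T).
Proof.
suff : [set A : set (set T) | card_lt [set: T] A] !=set0.
  by move=> /least_cardP[].
exists setT; split; last exact: not_card_le_set.
by apply/card_leTP; exists set1 => x y /seteqP[/(_ x erefl)].
Qed.

Lemma card_le_succ (T : Type) : [set: T] #<= [set: succ_card T].
Proof. by rewrite (card_le_eqr (card_setT _)); have [] := succ_cardP T. Qed.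

Lemma not_card_succ_le (T : Type) : ~ ([set: succ_card T] #<= [set: T]).
Proof. by rewrite (card_le_eql (card_setT _)); have [] := succ_cardP T. Qed.

(** If [U] embeds into [succ_card T], its image is a set of subsets of [T] larger than [T], to which
    the minimality of the successor applies. *)
Lemma succ_card_le (T U : Type) : ~ ([set: U] #<= [set: T]) ->
  [set: succ_card T] #<= [set: U].
Proof.
move=> nUT; have [//|/card_leTP[f finj]] := card_le_total (succ_card T) U.
pose A := range (fun u => set_val (f u)).
have AU : A #= [set: U] by apply: inj_card_eq => u v _ _ /val_inj /finj.
rewrite (card_le_eql (card_setT _)) -(card_le_eqr AU).
have [|_] := @least_cardP _ [set A : set (set T) | card_lt [set: T] A].
  by exists (succ_card T); exact: succ_cardP.
apply; split; rewrite ?(card_le_eqr AU) ?(card_le_eql AU) //.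
by have [] := card_le_total T U.
Qed.

Lemma infinite_aleph n : infinite_set [set: aleph n].
Proof.
elim: n => [|n /infiniteP IH]; first exact: infinite_nat.
exact/infiniteP/(card_le_trans IH)/card_le_succ.
Qed.

(** * Well-orders and coverings of countable subsets *)

Lemma well_orderP (T : Type) (le : rel T) : wochoice.well_order le ->
  let lt x y := le x y /\ x <> y in
  [/\ well_founded lt, forall x y z, lt x y -> lt y z -> lt x z
    & forall x y, [\/ lt x y, x = y | lt y x]].
Proof.
move=> wo lt.
have min (A : set T) x : A x -> exists z, A z /\ forall y, A y -> le z y.
  move=> Ax; have [|z [[+ zA] _]] := wo (mem A); first by exists x; exact: mem_set.
  by move=> /set_mem Az; exists z; split=> // y Ay; apply: zA; exact: mem_set.
(* The order axioms come from least elements of sets of at most three elements; antisymmetry uses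
   their uniqueness. *)
have anti x y : le x y -> le y x -> x = y.
  move=> xy yx.
  have lexx u : le u u by have [t [-> /(_ _ erefl)]] := min [set u] u erefl.
  have [|z [_ zu]] := wo (mem [set x; y]); first by exists x; apply/mem_set; left.
  have le2 u v : [set x; y] u -> [set x; y] v -> le u v by move=> [->|->] [->|->].
  have zm u : [set x; y] u -> z = u.
    move=> Au; apply: zu; split; first exact: mem_set.
    by move=> v /set_mem; exact: le2.
  by rewrite -(zm x) ?(zm y) //; [right|left].
have tot x y : le x y \/ le y x.
  have [m [[->|->] mle]] := min [set x; y] x (or_introl erefl).
    by left; apply: mle; right.
  by right; apply: mle; left.
have trans x y z : le x y -> le y z -> le x z.
  move=> xy yz; have [m [mA mle]] := min [set x; y; z] x (or_introl (or_introl erefl)).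
  case: mA mle => [[->|->]|->] mle.
  - by apply: mle; right.
  - by rewrite (anti x y) //; apply: mle; left; left.
  - by rewrite -(anti y z) //; apply: mle; left; right.
split.
- move=> x; apply: contrapT => nAx.
  have [z [nAz zle]] := min [set x | ~ Acc lt x] x nAx.
  apply: nAz; split=> y [yz nyz]; apply: contrapT => nAy.
  by apply: nyz; apply: anti => //; exact: zle.
- move=> x y z [xy nxy] [yz nyz]; split; first exact: trans xy yz.
  by move=> xz; subst z; apply: nxy; exact: anti.
- move=> x y; have [|nxy] := pselect (x = y); first by constructor 2.
  by have [] := tot x y => ?; [constructor 1|constructor 3]; split=> // /esym.
Qed.

Lemma exists_well_order (T : Type) : exists lt : T -> T -> Prop,
  [/\ well_founded lt, forall x y z, lt x y -> lt y z -> lt x z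
    & forall x y, [\/ lt x y, x = y | lt y x]].
Proof.
elim/Pchoice: T => T; have [le /well_orderP[? ? ?]] := wochoice.well_ordering_principle T.
by exists (fun x y => le x y /\ x <> y).
Qed.

(** A well-order of [T] is cut at the least element whose initial segment does not inject into [S],
    if there is one. For [S = nat] the result has order type omega_1. *)
Lemma exists_initial_order (S T : Type) : ~ ([set: T] #<= [set: S]) ->
  exists (V : set T) (lt : V -> V -> Prop),
    [/\ well_founded lt, forall x y z, lt x y -> lt y z -> lt x z,
        ~ ([set: V] #<= [set: S]),
        forall x y, [\/ lt x y, x = y | lt y x]
      & forall a, [set b | lt b a] #<= [set: S]].
Proof.
move=> nTS; have [lt [wf tr tot]] := exists_well_order T.
have build (V : set T) : ~ ([set: V] #<= [set: S]) ->
    (forall a, V a -> [set b | lt b a] #<= [set: S]) ->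
    exists (V : set T) (lt : V -> V -> Prop),
    [/\ well_founded lt, forall x y z, lt x y -> lt y z -> lt x z,
        ~ ([set: V] #<= [set: S]),
        forall x y, [\/ lt x y, x = y | lt y x]
      & forall a, [set b | lt b a] #<= [set: S]].
  move=> nVS Vseg; exists V, (fun x y => lt (val x) (val y)); split.
  - move=> x; move: {2}(val x) (erefl (val x)) => a.
    elim/(well_founded_ind wf): a x => a IH x xa; split=> y yx.
    by apply: (IH (val y)) => //; rewrite -xa.
  - by move=> x y z; exact: tr.
  - exact: nVS.
  - move=> x y; have [?|/val_inj ?|?] := tot (val x) (val y);
    by [constructor 1|constructor 2|constructor 3].
  - move=> a; apply: card_le_trans (Vseg _ (set_valP a)); apply/card_leSP.
    have ltP (b : [set b : V | lt (val b) (val a)]) :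
      [set b | lt b (val a)] (val (val b)) by exact: (set_valP b).
    exists (fun b => SigSub (mem_set (ltP b))) => x y [].
    by move=> /val_inj /val_inj.
have [[a0 na0]|nE] :=
    pselect (exists a, ~ ([set b | lt b a] #<= [set: S])); last first.
  apply: (build setT); first by rewrite (card_le_eql (card_setT _)).
  by move=> a _; apply: contrapT => na; apply: nE; exists a.
elim/(well_founded_ind wf): a0 na0 => a IH na.
have [[b [ba nb]]|nE] :=
    pselect (exists b, lt b a /\ ~ ([set c | lt c b] #<= [set: S])).
  exact: (IH b).
apply: (build [set b | lt b a]); first by rewrite (card_le_eql (card_setT _)).
by move=> b ba; apply: contrapT => nb; apply: nE; exists b.
Qed.

(** Regularity of a successor cardinal. Without a bound, every element of [V] would fail to be above
    some [s i]; those not above a given [s i] are [s i] itself and a segment injecting into [S], so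
    [V] would inject into [S]. *)
Lemma initial_order_bounded (I S V : Type) (lt : V -> V -> Prop) (s : I -> V) :
  infinite_set [set: S] -> [set: I] #<= [set: S] -> ~ ([set: V] #<= [set: S]) ->
  (forall x y, [\/ lt x y, x = y | lt y x]) ->
  (forall a, [set b | lt b a] #<= [set: S]) ->
  exists a, forall i, lt (s i) a.
Proof.
move=> Sinf IS nVS tot seg; apply: contrapT => nb.
have /choice[f fP] (a : V) : exists i, ~ lt (s i) a.
  by apply: contrapT => ni; apply: nb; exists a => i; apply: contrapT => ?;
    apply: ni; exists i.
have /choice[g gP] i : exists g : V -> option S, forall x y,
    ~ lt (s i) x -> ~ lt (s i) y -> g x = g y -> x = y.
  have := seg (s i); rewrite -(card_le_eql (card_setT _)).
  move=> /card_leTP[h hinj].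
  pose g x := if pselect (lt x (s i)) is left p
    then Some (h (SigSub (mem_set (p : [set b | lt b (s i)] x)))) else None.
  exists g => x y nx ny; rewrite /g.
  case: pselect => [p|np]; case: pselect => [q|nq] //.
    by move=> [/hinj []].
  by have [//|<- _|//] := tot (s i) x; have [//|<-|//] := tot (s i) y.
apply: nVS; apply: (@card_le_trans _ _ _ [set: I * option S]).
  apply/card_leTP; exists (fun x => (f x, g (f x) x)) => x y [fxy].
  by rewrite -fxy; apply: gP => //; rewrite fxy.
apply: card_le_trans (card_le_square Sinf); apply: card_leX => //.
apply: card_le_trans (card_le_square Sinf).
have /infiniteP/card_leTP[e einj] := Sinf.
apply/card_leTP; exists (fun o => if o is Some x then (e 0%N, x) else (e 1%N, e 0%N)).
by move=> [x|] [y|] // [] => [->|/einj|/einj].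
Qed.

(** The ranges of the [C i] are cofinal among the countable subsets. In the induction a sequence is
    bounded in [V] by some [a], so it lies in a segment enumerated by [aleph n], where the previous
    family applies; an index is now a pair of [a] and a previous index. *)
Lemma aleph_covering n : exists C : aleph n -> nat -> aleph n,
  forall s : nat -> aleph n, exists i, forall m, exists k, C i k = s m.
Proof.
elim: n => [|n [C CP]].
  by exists (fun _ k => k) => s; exists 0%N => m; exists (s m).
pose S := aleph n; pose T := aleph n.+1.
have Sinf : infinite_set [set: S] by exact: infinite_aleph.
have ST : [set: S] #<= [set: T] by exact: card_le_succ.
have [V [lt [_ _ nVS tot seg]]] := @exists_initial_order S T (@not_card_succ_le S).
have VT : [set: V] #<= [set: T] by rewrite (card_le_eql (card_setT _)); exact: card_leT.
have /card_leTP[f finj] : [set: T] #<= [set: V] by exact: succ_card_le nVS.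
have /card_leTP[h hinj] : [set: V * S] #<= [set: T].
  exact: card_le_trans (card_leX VT ST) (card_le_square (@infinite_aleph n.+1)).
have /infiniteP/card_leTP[u _] : infinite_set [set: T] by exact: infinite_aleph.
have /choice[g gP] (a : V) : exists g : S -> V, forall b, lt b a -> exists i, g i = b.
  have := seg a; rewrite -(card_le_eql (card_setT _)) => /card_leTP[k kinj].
  exists (fun i => if pselect (exists b, k b = i) is left p then val (projT1 (cid p))
    else a) => b ba.
  exists (k (SigSub (mem_set (ba : [set b | lt b a] b)))).
  by case: pselect => [p|[]]; [case: cid => x /= /kinj ->|eexists].
pose finv (v : V) := if pselect (exists t, f t = v) is left p
  then projT1 (cid p) else u 0%N.
have fK t : finv (f t) = t.
  by rewrite /finv; case: pselect => [p|[]]; [case: cid => x /= /finj|exists t].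
exists (fun t k => if pselect (exists p, h p = t) is left q then
  let p := projT1 (cid q) in finv (g p.1 (C p.2 k)) else u 0%N) => s.
have natS : [set: nat] #<= [set: S] by exact/infiniteP.
have [a aP] := initial_order_bounded (f \o s) Sinf natS nVS tot seg.
have /choice[r rP] m : exists i, g a i = f (s m) by exact: gP (aP m).
have [i iP] := CP r; exists (h (a, i)) => m; have [k ik] := iP m.
exists k; case: pselect => [p|[]]; last by exists (a, i).
by case: cid => q /= /hinj -> /=; rewrite ik rP fK.
Qed.

(** * Cofinalities and domination *)

Lemma cofP (P : Type) (le : P -> P -> Prop) : (forall x, le x x) ->
  cofinal le (cof le) /\ forall C, cofinal le C -> cof le #<= C.
Proof. by move=> lexx; apply: least_cardP; exists setT => x; exists x. Qed.

(** The image of [C] under [phi] is cofinal. *)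
Lemma cof_surj (P Q : Type) (leQ : Q -> Q -> Prop)
    (C : set P) (phi : P -> Q) : (forall y, leQ y y) ->
  (forall y, exists2 x, C x & leQ y (phi x)) -> cof leQ #<= C.
Proof.
move=> lexx h; apply: card_le_trans (card_image_le phi C).
by apply: (cofP lexx).2 => y; have [x Cx yx] := h y; exists (phi x) => //; exists x.
Qed.

(** Diagonalization: [g] exceeds at [n] the member of [D] numbered [n]. *)
Lemma not_countable_dominating (D : set (nat -> nat)) :
  cofinal (pointwise (fun m n => (m <= n)%N)) D -> ~ countable D.
Proof.
move=> cD /countable_injP[e einj].
pose g n := if pselect (exists f, D f /\ e f = n) is left h
  then (projT1 (cid h) n).+1 else 0%N.
have [f Df /(_ (e f))] := cD g.
rewrite /g; case: pselect => [h|[]]; last by exists f.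
case: cid => f' [Df' ff'] /=.
by rewrite (einj _ _ (mem_set Df') (mem_set Df) ff') ltnn.
Qed.

Lemma finite_set_bounded (T : Type) (A : set T) (Q : T -> nat -> Prop) :
  finite_set A -> (forall t, A t -> exists k, Q t k) ->
  exists N, forall t, A t -> exists2 k, (k <= N)%N & Q t k.
Proof.
elim/Pchoice: T => T in A Q *.
move=> /finite_seqP[s ->] AQ.
have /choice[k kP] (t : T) : exists k, t \in s -> Q t k.
  by case: (boolP (t \in s)) => [/AQ[k ?]|_]; [exists k|exists 0%N].
exists (\max_(t <- s) k t) => t /= ts; exists (k t); last exact: kP.
exact: leq_bigmax_seq.
Qed.

(** A pair of [i] and [f] yields the finite sets of terms of [C i] up to rank [f m]. The union of
    the [h m] is countable, so some [C i] covers it, and a dominating [f] bounds the ranks needed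
    for each [h m]. *)
Lemma cof_finsets_omega_aleph n :
  cof_finsets_omega (aleph n) #<= [set: aleph n * dominating_number].
Proof.
have [C CP] := aleph_covering n.
have [cofD _] : cofinal _ dominating_number /\ _ :=
  cofP (le := pointwise (fun m n : nat => (m <= n)%N)) (fun f i => leqnn _).
have finC (i : aleph n) (m : nat) :
    [set A : set (aleph n) | finite_set A] (C i @` [set k | (k <= m)%N]).
  by apply: finite_image; apply: sub_finite_set (finite_II m.+1).
apply: (cof_surj (phi := fun p m => SigSub (mem_set (finC p.1 (val p.2 m))))).
  by move=> f m t.
move=> h.
have finh m : finite_set (val (h m)) by exact: (set_valP (h m)).
have /infiniteP/card_leTP[u _] := @infinite_aleph n.
have [e einj] : exists e : aleph n -> nat, {in \bigcup_m val (h m) &, injective e}.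
  apply/countable_injP/bigcup_countable => // m _; exact: finite_set_countable.
pose s k := if pselect (exists t, (\bigcup_m val (h m)) t /\ e t = k) is left p
  then projT1 (cid p) else u 0%N.
have sP m t : val (h m) t -> s (e t) = t.
  move=> ht; have Ut : (\bigcup_m val (h m)) t by exists m.
  rewrite /s; case: pselect => [p|[]]; last by exists t.
  by case: cid => t' [Ut' /= tt']; apply: einj => //; exact: mem_set.
have [i iP] := CP s.
have /choice[g gP] m : exists N, forall t, val (h m) t ->
    exists2 k, (k <= N)%N & C i k = t.
  apply: finite_set_bounded => // t /sP <-; exact: iP.
have [f Df gf] := cofD g.
exists (i, SigSub (mem_set Df)) => // m t /= /gP[k kg <-].
by exists k => //=; exact: leq_trans kg (gf m).
Qed.

(** * Compact subsets of metrizable spaces *)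

(** If [P K] fails, the sets [X] such that [P] holds for the rest of [K] outside [X] form a proper
    filter. It contains the complement of every [U] with [P (U]&[K)], so no point of [K] is a
    cluster point. *)
Lemma compact_ideal (T : topologicalType) (K : set T) (P : set T -> Prop) :
  compact K -> P set0 -> (forall A C, A `<=` C -> P C -> P A) ->
  (forall A C, P A -> P C -> P (A `|` C)) ->
  (forall x, K x -> exists2 U, nbhs x U & P (U `&` K)) -> P K.
Proof.
move=> cK P0 Psub PU Ploc; apply: contrapT => nPK.
pose F : set_system T := [set X | P (K `\` X)].
have FF : ProperFilter F.
  apply: Build_ProperFilter_ex; last split.
  - move=> X FX; apply: contrapT => X0; apply: nPK; apply: Psub FX => x Kx.
    by split=> // Xx; apply: X0; exists x.
  - by rewrite /F/= setDT.
  - by move=> X Y FX FY; rewrite /F/= setDIr; exact: PU.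
  - by move=> X Y XY; apply: Psub; exact: setDS.
have [|x [Kx clx]] := cK F FF; first by rewrite /F/= setDv.
have [U Ux PUK] := Ploc x Kx.
have [||y [nUy Uy]] := clx (~` U) U => //.
by rewrite /F/= setDE setCK setIC.
Qed.

Lemma compact_bigcup_finite (T : topologicalType) (I : Type) (D : set I)
    (F : I -> set T) : finite_set D ->
  (forall i, D i -> compact (F i)) -> compact (\bigcup_(i in D) F i).
Proof.
elim/Pchoice: I => I in D F * => fD cF.
rewrite (eq_bigcupr (G := fun i => if i \in D then F i else set0)); last first.
  by move=> i Di; rewrite mem_set.
rewrite -bigsetU_fset_set //; apply: bigsetU_compact => i _.
by case: ifPn => [/set_mem/cF//|_]; exact: compact0.
Qed.

Section metric.
Local Open Scope ring_scope.
Context (R : realType) (T : topologicalType) (d : T -> T -> R).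
Hypothesis dxx : forall x, d x x = 0.
Hypothesis d0 : forall x y, d x y = 0 -> x = y.
Hypothesis dC : forall x y, d x y = d y x.
Hypothesis dtri : forall y x z, d x z <= d x y + d y z.
Hypothesis nbhsd : forall x, nbhs x = filter_from [set e : R | 0 < e]
                                       (fun e => [set y | d x y < e]).

Let d_ge0 x y : 0 <= d x y.
Proof. by have := dtri y x x; rewrite dxx (dC y x); lra. Qed.

Let d_gt0 x y : y <> x -> 0 < d x y.
Proof.
by move=> yx; rewrite lt_neqAle d_ge0 andbT; apply/eqP => /esym/d0/esym.
Qed.

Let nbhs_d x e : 0 < e -> nbhs x [set y | d x y < e].
Proof. by rewrite nbhsd; exists e. Qed.

Let nbhs_dP x U : nbhs x U -> exists2 e : R, 0 < e & forall y, d x y < e -> U y.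
Proof. by rewrite nbhsd => -[e e0 h]; exists e. Qed.

Lemma closed_cball x e : closed [set y | d x y <= e].
Proof.
move=> p clp; rewrite /= leNgt; apply/negP => ep.
have [|y [/= xy py]] := clp [set y | d p y < d x p - e].
  by apply: nbhs_d; rewrite subr_gt0.
by have := dtri y x p; rewrite (dC y p); lra.
Qed.

Lemma closed_dge x e : closed [set y | e <= d x y].
Proof.
move=> p clp; rewrite /= leNgt; apply/negP => ep.
have [|y [/= xy py]] := clp [set y | d p y < e - d x p].
  by apply: nbhs_d; rewrite subr_gt0.
by have := dtri p x y; lra.
Qed.

Lemma hausdorff_metric : hausdorff_space T.
Proof.
move=> p q clpq; apply: contrapT => /d_gt0; rewrite dC => pq.
have hp : 0 < d p q / 2 by lra.
have [y [/= py qy]] := clpq _ _ (nbhs_d p hp) (nbhs_d q hp).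
by have := dtri y p q; rewrite (dC y q); lra.
Qed.

(** * Crowded sets and Cantor schemes *)

Definition crowded (P : set T) :=
  forall x e, P x -> 0 < e -> exists y, [/\ P y, y <> x & d x y < e].

Section cantor_scheme.
Context (x0 : T) (nx : T -> R -> T).

(** Center and radius of the ball selected by the first [n] digits of [c]. A radius of a third of
    the distance between the two candidate centers makes their closed balls disjoint. *)
Fixpoint scheme (c : nat -> bool) n : T * R :=
  if n is m.+1 then
    let: (x, r) := scheme c m in
    let y := nx x r in (if c m then y else x, d x y / 3)
  else (x0, 1).

Lemma eq_scheme c c' n : (forall i, (i < n)%N -> c i = c' i) ->
  scheme c n = scheme c' n.
Proof.
elim: n => //= n IH cc; rewrite IH => [|i /ltnW]; last exact: cc.
by rewrite cc.
Qed.

End cantor_scheme.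

(** Branches of the scheme have limits because their centers lie in the compact set [L]; the limit
    map is an embedding since the Cantor space is compact and [T] is Hausdorff. *)
Lemma crowded_embedding (P L : set T) :
  P !=set0 -> P `<=` L -> compact L -> crowded P ->
  exists f : cantor_space -> T, embedding f.
Proof.
move=> [x0 Px0] PL cL crP.
(* Moving by less than half the radius nests the closed balls, as 1/2 + 1/6 < 1, and at least halves
   the radius. *)
have /choice[nx nxP] (p : T * R) : exists y, P p.1 -> 0 < p.2 ->
    [/\ P y, y <> p.1 & d p.1 y < p.2 / 2].
  have [[Pp p0]|nP] := pselect (P p.1 /\ 0 < p.2).
    have [|y ?] := crP p.1 (p.2 / 2) Pp; first by lra.
    by exists y.
  by exists x0 => ? ?; case: nP.
pose s := scheme x0 (fun x r => nx (x, r)).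
have sP c n : P (s c n).1 /\ 0 < (s c n).2.
  elim: n => [|n] /=; first by split=> //; exact: ltr01.
  rewrite -/(s c n); case: (s c n) => x r [/= Px r0].
  have [Py /d_gt0 yx _] := nxP (x, r) Px r0.
  by split; [case: (c n)|lra].
have sS c n : d (s c n).1 (s c n.+1).1 + (s c n.+1).2 <= (s c n).2 /\
    2 * (s c n.+1).2 <= (s c n).2.
  have [] := sP c n; rewrite /= -/(s c n); case: (s c n) => x r /= Px r0.
  have [_ _ /=] := nxP (x, r) Px r0; have := d_ge0 x (nx (x, r)).
  by case: (c n); rewrite ?dxx; lra.
have sm c n m : d (s c n).1 (s c (n + m)%N).1 + (s c (n + m)%N).2 <= (s c n).2.
  elim: m => [|m IH]; first by rewrite addn0 dxx add0r.
  have [+ _] := sS c (n + m)%N; rewrite -addnS.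
  by have := dtri (s c (n + m)%N).1 (s c n).1 (s c (n + m.+1)%N).1; lra.
have s0 c n : (s c n).2 * n.+1%:R <= 1.
  elim: n => [|n IH]; first by rewrite /= mulr1.
  have [_ h] := sS c n; have [_ p0] := sP c n.+1; rewrite -natr1.
  apply: le_trans IH; have n1 : 1 <= n.+1%:R :> R by rewrite ler1n.
  apply: (@le_trans _ _ ((2 * (s c n.+1).2) * n.+1%:R)); last first.
    by rewrite ler_wpM2r//; lra.
  by nra.
have /choice[f fP] (c : cantor_space) : exists z, forall n, d (s c n).1 z <= (s c n).2.
  have [|z [_ clz]] := cL ((fun n => (s c n).1) @ \oo) _ _.
    by exists 0%N => // n _; apply: PL; have [] := sP c n.
  exists z => n; apply: (@closed_cball (s c n).1 (s c n).2) => U Uz.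
  have [||y [? ?]] := clz [set y | d (s c n).1 y <= (s c n).2] U => //.
    exists n => // m /= nm; rewrite -(subnKC nm).
    by have := sm c n (m - n)%N; have [_] := sP c (n + (m - n))%N; lra.
  by exists y.
have finj : injective f.
  move=> c c' cc'; apply/funext => i; apply: contrapT => ci.
  (* Up to the first differing digit both branches select the same ball; right after it their closed
     balls are disjoint. *)
  have ex : exists i, c i != c' i by exists i; apply/eqP.
  case: (ex_minnP ex) => n cn mn.
  have sn : s c n = s c' n.
    by apply: eq_scheme => j jn; apply: contrapT => /eqP /mn; rewrite leqNgt jn.
  have := fP c n.+1; have := fP c' n.+1; rewrite /= -/(s c n) -/(s c' n) -sn -cc'.
  have [] := sP c n; case: (s c n) => x r /= Px r0.
  have [_ /d_gt0 yx _] := nxP (x, r) Px r0.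
  have := dtri (f c) x (nx (x, r)); rewrite (dC (f c) (nx _)) /= in yx *.
  by case: (c n) (c' n) cn => [] [] //= _; lra.
have fcont : continuous f.
  move=> c U /nbhs_dP[e e0 eU].
  have [n ne] : exists n, 2 * (s c n).2 < e.
    exists (Num.truncn (2 / e)).
    have := s0 c (Num.truncn (2 / e)); have [_] := sP c (Num.truncn (2 / e)).
    have := truncnS_gt (2 / e); rewrite ltr_pdivrMr //.
    have : 0 < (Num.truncn (2 / e)).+1%:R :> R by rewrite ltr0Sn.
    set k := _.+1%:R; set r := (s c _).2 => k0 h r0 rk.
    rewrite ltNge; apply/negP => le.
    by have : 2 < 2 * (r * k); [apply: lt_le_trans h _; nra|lra].
  have cyl m : nbhs c [set c' : cantor_space | forall i, (i < m)%N -> c i = c' i].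
    elim: m => [|m IH]; first by apply: filterS filterT.
    have cm : nbhs c [set c' : cantor_space | c m = c' m].
      have : nbhs (c m) [set c m] by exact: discrete_set1.
      by move=> /(@proj_continuous nat (fun=> bool) m c); apply: filterS => c' /= ->.
    apply: filterS (filterI IH cm) => c' [/= h hm] i; rewrite ltnS leq_eqVlt.
    by move=> /orP[/eqP ->|/h].
  apply: filterS (cyl n) => c' cc'; apply: eU.
  have := fP c n; have := fP c' n; have <- : s c n = s c' n by exact: eq_scheme.
  by have := dtri (s c n).1 (f c) (f c'); rewrite (dC (f c) (s c n).1); lra.
(* The image of the complement of [O] is compact, hence closed; by injectivity, what remains of the
   range is the image of [O]. *)
exists f; split=> // O oO; exists (~` (f @` ~` O)).
  apply: closed_openC; apply: compact_closed hausdorff_metric _.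
  apply: continuous_compact; first exact: continuous_subspaceT.
  apply: (@subclosed_compact _ _ [set: cantor_space]) => //.
    exact: open_closedC.
  exact: cantor_space_compact.
apply/seteqP; split=> [_ [c Oc <-]|t [nO [c _ ct]]].
  by split; [case=> c' nO /finj cc; rewrite cc in nO|exists c].
by exists c => //; apply: contrapT => nOc; apply: nO; exists c.
Qed.

(** [N] collects the points where [P] fails locally. It is crowded: if [x] in [N] had no other point
    of [N] within [e], then [compact_ideal] would give [P] on the ball of radius [e / 2] outside
    each smaller ball around [x], and the limit hypothesis would give [P] near [x]. *)
Lemma compact_induction (K : set T) (P : set T -> Prop) :
  totally_imperfect T -> compact K ->
  P set0 -> (forall A C, A `<=` C -> P C -> P A) ->
  (forall A C, P A -> P C -> P (A `|` C)) ->
  (forall x C, K x -> C `<=` K ->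
    (forall e, 0 < e -> P (C `&` [set y | e <= d x y])) -> P C) ->
  P K.
Proof.
move=> tiT cK P0 Psub PU Plim.
pose N := [set x | K x /\ forall U, nbhs x U -> ~ P (U `&` K)].
have [N0|N0] := pselect (N !=set0); last first.
  apply: compact_ideal => // x Kx; apply: contrapT => nU; apply: N0; exists x.
  by split=> // U Ux PUK; apply: nU; exists U.
exfalso; apply: tiT; apply: (crowded_embedding N0 (L := K)) => // [x []//|].
move=> x e [Kx Nx] e0; apply: contrapT => ny.
have e20 : 0 < e / 2 by lra.
apply: (Nx _ (nbhs_d x e20)).
pose C := K `&` [set y | d x y <= e / 2].
apply: (Psub _ C) => [y [/= /ltW ? Ky]//|].
apply: (Plim x) => [//|y []//|e' e'0]; apply: compact_ideal => //.
  apply: compact_closedI; last exact: closed_dge.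
  by apply: compact_closedI => //; exact: closed_cball.
move=> y [[Ky /= xy] e'y]; apply: contrapT => nU; apply: ny; exists y; split.
- split=> // U Uy PUK; apply: nU; exists U => //; apply: Psub PUK.
  by move=> z [Uz [[Kz _] _]].
- by move=> yx; move: e'y; rewrite yx dxx; lra.
- by lra.
Qed.

(** Outside a neighborhood of [x] the set is covered by finitely many [D n], so a filter that does
    not cluster at [x] clusters in their union. *)
Lemma compact_fan x (G : nat -> set T) : (forall n, compact (G n)) ->
  compact [set y | y = x \/ exists2 n, G n y & d x y * n%:R <= 1].
Proof.
move=> cG; set E := [set y | _] => F FF FE.
have [clx|] := pselect (cluster F x); first by exists x; split=> //; left.
move=> /existsNP[A] /existsNP[U] /not_implyP[FA] /not_implyP[+ AU].
move=> /nbhs_dP[e e0 eU].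
pose N := Num.truncn e^-1.
pose D n := G n `&` [set y | d x y * n%:R <= 1].
have cD n : compact (D n).
  apply: compact_closedI => //; case: n => [|n].
    rewrite (_ : [set y | _] = setT) ?closedT//.
    by apply/seteqP; split=> // y _ /=; rewrite mulr0 ler01.
  rewrite (_ : [set y | _] = [set y | d x y <= n.+1%:R^-1]); first exact: closed_cball.
  by apply/seteqP; split=> y /=; rewrite -[_^-1]div1r ler_pdivlMr ?ltr0Sn.
pose EN := \bigcup_(n < N.+1) D n.
have cEN : compact EN.
  rewrite /EN bigcup_mkord; apply: bigsetU_compact => i _; exact: cD.
have [|y [[n _ [Gy xy]] cly]] := cEN F FF; last first.
  by exists y; split=> //; right; exists n.
apply: filterS (filterI FA FE) => y [Ay Ey].
have nUy : ~ U y by move=> Uy; apply: AU; exists y.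
case: Ey => [yx|[n Gy xy]]; first by case: nUy; apply: eU; rewrite yx dxx.
exists n => //=; rewrite ltnNge; apply/negP => Nn; apply: nUy; apply: eU.
have en : e^-1 < n%:R.
  by apply: lt_le_trans (truncnS_gt _) _; rewrite ler_nat.
have n0 : 0 < n%:R :> R by apply: lt_trans en; rewrite invr_gt0.
have : 1 < n%:R * e by rewrite -ltr_pdivrMr // div1r.
by have := d_ge0 x y; nra.
Qed.

(** Otherwise every nonempty set has an isolated point. If no derivative along a well-order of
    [set T] were empty, choosing an isolated point at each stage would inject [set T] into [T]. *)
Lemma not_scattered_crowded : ~ scattered T -> exists2 P, P !=set0 & crowded P.
Proof.
move=> nsc; apply: contrapT => nP; apply: nsc.
have iso (A : set T) : A !=set0 -> exists x, isolated A x.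
  move=> A0; apply: contrapT => niso; apply: nP; exists A => // x e Ax e0.
  apply: contrapT => ny; apply: niso; exists x; split; first exact: mem_set.
  exists [set y | d x y < e]; first exact: nbhs_d.
  apply/seteqP; split=> [y [/= xy Ay]|_ -> /=]; last by rewrite dxx.
  by apply: contrapT => yx; apply: ny; exists y.
have [le wo] := wochoice.well_ordering_principle (set T : eqType).
have [wf _ tot] := well_orderP wo.
pose lt x y := le x y /\ x <> y.
pose X := Fix wf (fun=> set T) (fun a rec =>
  [set x | forall b (ba : lt b a), ~ isolated (rec b ba) x]).
have XE a : X a = [set x | forall b, lt b a -> ~ isolated (X b) x].
  rewrite /X Fix_eq // => c f g fg; apply/seteqP; split=> x h b ba;
  by [rewrite -fg; exact: h|rewrite fg; exact: h].
exists (set T), le, X; split=> // [a|].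
  rewrite XE; apply/seteqP; split=> [x h|x [_ h] b ba ix].
    by split=> // -[b ba]; exact: h.
  by apply: h; exists b.
apply: contrapT => nX0.
have /choice[t tP] (a : set T) : exists x, isolated (X a) x.
  by apply: iso; apply/set0P/negP => /eqP Xa; apply: nX0; exists a.
apply: (@not_card_le_set T); apply/card_leTP; exists t => a b tab.
have key a' b' : lt a' b' -> t a' <> t b'.
  move=> ab e; have /isolatedS := tP b'; rewrite XE => /(_ _ ab); apply.
  by rewrite -e.
by have [/key|//|/key/nesym] := tot a b.
Qed.

(** A filter containing [C] has no cluster point in [C]. The basic balls whose complement is in the
    filter cover [C], but finitely many of them never do. *)
Lemma not_compact_cover (C : set T) : separable T -> ~ compact C ->
  exists U : nat -> set T, [/\ forall n, open (U n),
    forall m n, (m <= n)%N -> U m `<=` U n,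
    C `<=` \bigcup_n U n & forall n, ~ C `<=` U n].
Proof.
move=> [S /countable_injP[e einj] dS].
move=> /existsNP[F] /existsNP[FF] /not_implyP[FC nclus].
pose ballS (n : nat) : set T := [set y | exists s i,
  [/\ S s, n = choice.pickle (e s, i) & d s y * i.+1%:R < 1 ]].
have ballO n : open (ballS n).
  rewrite openE => y [s [i [Ss -> sy]]].
  have i0 : 0 < i.+1%:R :> R by rewrite ltr0Sn.
  have sy' : d s y < i.+1%:R^-1 by rewrite -[_^-1]div1r ltr_pdivlMr.
  have h : 0 < i.+1%:R^-1 - d s y by rewrite subr_gt0.
  apply: filterS (nbhs_d y h) => z /= yz; exists s, i; split=> //.
  rewrite -ltr_pdivlMr // div1r.
  by apply: le_lt_trans (dtri y s z) _; rewrite -ltrBrDl.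
pose V n := if pselect (F (~` ballS n)) then ballS n else set0.
pose U n := \bigcup_(i < n.+1) V i.
exists U; split.
- move=> n; apply: bigcup_open => i _; rewrite /V; case: pselect => ?.
    exact: ballO.
  exact: open0.
- by move=> m n mn x [i /= im Vx]; exists i => //=; exact: leq_trans im _.
- move=> x Cx; have [clx|] := pselect (cluster F x); first by case: nclus; exists x.
  move=> /existsNP[A] /existsNP[W] /not_implyP[FA] /not_implyP[+ AW].
  move=> /nbhs_dP[r r0 rW].
  (* Two radii fit in [r], so a ball of this radius around [s] that contains [x] lies within [r] of
     [x]. *)
  pose i := Num.truncn (2 / r).
  have i0 : 0 < i.+1%:R :> R by rewrite ltr0Sn.
  have ir : 2 * i.+1%:R^-1 < r.
    by rewrite ltr_pdivrMr // mulrC -ltr_pdivrMr //; exact: truncnS_gt.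
  have [|s [/= /nbhs_singleton /= xs Ss]] :=
      dS _ _ (open_interior [set y | d x y < i.+1%:R^-1]).
    by exists x; apply: nbhs_d; rewrite invr_gt0.
  have bi y : d s y * i.+1%:R < 1 <-> d s y < i.+1%:R^-1.
    by rewrite -[_^-1]div1r ltr_pdivlMr.
  exists (choice.pickle (e s, i)) => //.
  exists (choice.pickle (e s, i)) => //=.
  rewrite /V; case: pselect => [?|[]].
    by exists s, i; split=> //; apply/bi; rewrite dC.
  apply: filterS FA => y Ay [s' [i' [Ss' /(pcan_inj choice.pickleK) [ess' <-]]]].
  have <- : s = s' by apply: einj ess'; exact: mem_set.
  move=> /bi sy; apply: AW; exists y; split=> //; apply: rW.
  set q := _^-1 in ir xs sy; by have := dtri s x y; lra.
- move=> n CU; have : F set0; last exact: filter_not_empty.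
  have : F (\bigcap_(i < n.+1) ~` V i).
    rewrite bigcap_mkord; elim/big_ind : _ => [|A B|i _]; first exact: filterT.
      exact: filterI.
    rewrite /V; case: pselect => [?|?] //; rewrite setC0; exact: filterT.
  move=> /(filterI FC); apply: filterS => y [/CU[i /= iN Vy]] /(_ i iN); exact.
Qed.

(** * Countability of compact sets and the lower bounds *)

Let annulus x y : y <> x ->
  exists2 n : nat, d x y * n%:R <= 1 & n.+1%:R^-1 <= d x y.
Proof.
(* The integer part [n] of [1 / d x y] is 0 for distances above 1, where the first inequality is
   void. *)
move=> /d_gt0 xy; exists (Num.truncn (d x y)^-1).
  rewrite mulrC -ler_pdivlMr // div1r -[leRHS]/(_^-1).
  by rewrite -truncn_ge_nat // invr_ge0 ltW.
rewrite -[leRHS]invrK lef_pV2 ?posrE ?invr_gt0 //.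
  exact/ltW/truncnS_gt.
Qed.

Lemma compact_countable (K : set T) :
  totally_imperfect T -> compact K -> countable K.
Proof.
move=> tiT cK.
have cU (A C : set T) : countable A -> countable C -> countable (A `|` C).
  move=> cA cC; rewrite -bigcup2E; apply: bigcup_countable => // -[|[|n]] _ //=.
apply: (compact_induction (P := @countable T)) => // [A C AC cC|x C _ CK h].
  exact: sub_countable (subset_card_le AC) cC.
apply: (@sub_countable _ _ _ ([set x] `|`
    \bigcup_n (C `&` [set y | n.+1%:R^-1 <= d x y]))); last first.
  apply: cU; first exact: countable1.
  by apply: bigcup_countable => // n _; apply: h; rewrite invr_gt0.
apply: subset_card_le => y Cy; have [->|yx] := pselect (y = x); first by left.
by have [n _ ny] := annulus yx; right; exists n.
Qed.

(** Any point of a nonempty crowded set serves, as the trace of this set on an open ball is still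
    crowded. *)
Lemma not_locally_compact_point : totally_imperfect T -> ~ scattered T ->
  exists x, forall n : nat, ~ compact [set y | d x y <= n.+1%:R^-1].
Proof.
move=> tiT /(not_scattered_crowded)[P [x Px] crP].
exists x => n cL; apply: tiT; set e : R := _^-1 in cL.
have e0 : 0 < e by rewrite invr_gt0.
apply: (crowded_embedding (P := P `&` [set y | d x y < e])
  (L := [set y | d x y <= e])) => //.
- by exists x; split; rewrite //= dxx.
- by move=> y [_ /ltW].
- move=> y e' [Py /= xy] e'0.
  have [|z [Pz zy yz]] := crP y (Num.min e' (e - d x y)) Py.
    by rewrite lt_min e'0 subr_gt0.
  exists z; move: yz; rewrite lt_min => /andP[-> yz]; split=> //; split=> //=.
  by have := dtri y x z; lra.
Qed.

(** Given [f], points [t n] of the ball [n] outside [U n (f n)] form a compact set together with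
    their limit [x]. A compact [K] containing it has [phi K n > f n] for all [n], because [U n] is
    increasing. *)
Lemma dominating_le_compacts (C : set (set_type [set K : set T | compact K])) :
  separable T -> totally_imperfect T -> ~ scattered T ->
  cofinal (@Defs.incl T [set K : set T | compact K]) C -> dominating_number #<= C.
Proof.
move=> sT tiT /(not_locally_compact_point tiT)[x nx] cofC.
have /choice[U UP] n := not_compact_cover sT (@nx n).
pose ball n := [set y | d x y <= n.+1%:R^-1].
have /choice[phi phiP] (K : set_type [set K : set T | compact K]) :
    exists f : nat -> nat, forall n, val K `&` ball n `<=` U n (f n).
  suff /choice[f fP] n : exists m, val K `&` ball n `<=` U n m by exists f.
  have [oU mU cU _] := UP n.
  apply: (compact_ideal (P := fun A => exists m, A `&` ball n `<=` U n m)).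
  - exact: set_valP K.
  - by exists 0%N => y [].
  - by move=> A A' AA' [m h]; exists m => y [/AA' ? ?]; exact: h.
  - move=> A A' [m h] [m' h']; exists (maxn m m') => y [[Ay|Ay] yb].
      by apply: (mU m); [exact: leq_maxl|exact: h].
    by apply: (mU m'); [exact: leq_maxr|exact: h'].
  - move=> y _; have [yb|yb] := pselect (ball n y); last first.
      exists (~` ball n); last by exists 0%N => z [[]].
      by apply: open_nbhs_nbhs; split=> //; exact/closed_openC/closed_cball.
    have [m _ Um] := cU _ yb; exists (U n m); first exact: open_nbhs_nbhs.
    by exists m => z [[]].
apply: (cof_surj (phi := phi)) => [g n //|f].
have /choice[t tP] n : exists t, ball n t /\ ~ U n (f n) t.
  apply: contrapT => nt; have [_ _ _ /(_ (f n))] := UP n; apply => y yb.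
  by apply: contrapT => ny; apply: nt; exists y.
have cK : compact [set y | y = x \/ exists2 n, [set t n] y & d x y * n%:R <= 1].
  by apply: (compact_fan) => n; exact: compact_set1.
have [K CK sK] := cofC (SigSub (mem_set (cK : [set K | compact K] _))).
exists K => // n; rewrite leqNgt; apply/negP => fn.
have [tb ntU] := tP n; apply: ntU; have [_ mU _ _] := UP n.
apply: (mU (phi K n)); first exact: ltnW.
apply: phiP; split=> //; apply: sK => /=; right; exists n => //.
move: tb; rewrite /ball/= -[_^-1]div1r ler_pdivlMr //; apply: le_trans.
by rewrite ler_wpM2l // ler_nat.
Qed.

(** A point is determined by a member of [C] containing it and its number in that countable set. *)
Lemma card_le_compacts (C : set (set_type [set K : set T | compact K])) :
  totally_imperfect T -> cofinal (@Defs.incl T [set K : set T | compact K]) C ->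
  [set: T] #<= [set: C * nat].
Proof.
move=> tiT cofC.
have /choice[e eP] (K : C) : exists e : T -> nat, {in val (val K) &, injective e}.
  by apply/countable_injP; apply: compact_countable => //; exact: (set_valP (val K)).
have /choice[k kP] (x : T) : exists K : C, val (val K) x.
  have [K CK xK] := cofC (SigSub (mem_set (@compact_set1 T x : [set K | compact K] _))).
  by exists (SigSub (mem_set CK)); exact: xK.
apply/card_leTP; exists (fun x => (k x, e (k x) x)) => x y [kxy].
by rewrite -kxy; apply: eP; apply: mem_set => //; rewrite kxy.
Qed.

(** * Fans and the upper bound *)

Section tukey.
Context (kappa : Type) (j : T -> kappa).
Context (V : set kappa) (lt : V -> V -> Prop) (v0 : V).

(** The set [f [:: n]] does double duty: it lists the indices [b] of the branches with parameter [n]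
    and, through [j], their centers, since their code is [f] shifted by [n]. *)
Inductive fan : V -> (seq nat -> set kappa) -> T -> Prop :=
| fan_center a f x : f [::] (j x) -> fan a f x
| fan_branch a f x n b y : f [::] (j x) -> d x y * n%:R <= 1 -> lt b a ->
    f [:: n] (val b) -> fan b (fun s => f (n :: s)) y -> fan a f y.

(** This allows codes to be merged, or enlarged to members of a cofinal family. *)
Lemma fanS a f c g : (forall b, lt b a -> lt b c) ->
  (forall s, f s `<=` g s) -> fan a f `<=` fan c g.
Proof.
move=> ac fg y fy; elim: fy c g ac fg => {a f y}.
  by move=> a f x fx c g ac fg; apply: fan_center; exact: fg.
move=> a f x n b y fx xy ba fb _ IH c g ac fg.
apply: (@fan_branch c g x n b) => //; [exact: fg|exact: ac|exact: fg|].
exact: IH.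
Qed.

Lemma fan_inv a f y : fan a f y -> exists x, f [::] (j x) /\
  (y = x \/ exists n b, [/\ d x y * n%:R <= 1, lt b a, f [:: n] (val b)
                          & fan b (fun s => f (n :: s)) y]).
Proof.
case=> {a f y} [a f x fx|a f x n b y fx xy ba fb fy]; exists x; split=> //.
  by left.
by right; exists n, b.
Qed.

Hypothesis jinj : injective j.
Hypothesis wf : well_founded lt.

(** By induction on [a], the branches with parameter [n] form a finite union of compact sets, so
    [compact_fan] applies around each of the finitely many centers. *)
Lemma compact_fans a f : (forall s, finite_set (f s)) -> compact (fan a f).
Proof.
elim/(well_founded_ind wf): a f => a IH f finf.
pose G n := \bigcup_(b in [set b | f [:: n] (val b) /\ lt b a])
  fan b (fun s => f (n :: s)).
rewrite (_ : fan a f = \bigcup_(x in j @^-1` f [::])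
   [set y | y = x \/ exists2 n, G n y & d x y * n%:R <= 1]); last first.
  apply/seteqP; split=> [y fy|y [x fx [->|[n [b [fb ba] Gy] xy]]]].
  - have [x [fx [->|[n [b [xy ba fb Gy]]]]]] := fan_inv fy; exists x => //.
      by left.
    by right; exists n => //; exists b.
  - exact: fan_center.
  - exact: fan_branch fx xy ba fb Gy.
apply: compact_bigcup_finite.
  by apply: finite_preimage (finf _); exact: in2W.
move=> x _; apply: (compact_fan) => n.
apply: compact_bigcup_finite => [|b [_ ba]]; last by apply: IH.
apply: (@sub_finite_set _ _ (val @^-1` f [:: n])) => [b []//|].
by apply: finite_preimage (finf _); apply: in2W; exact: val_inj.
Qed.

Hypothesis tr : forall x y z, lt x y -> lt y z -> lt x z.
Hypothesis bounded : forall s : nat -> V, exists a, forall i, lt (s i) a.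

Lemma fan_cofinal K : totally_imperfect T -> compact K ->
  exists a f, (forall s, finite_set (f s)) /\ K `<=` fan a f.
Proof.
move=> tiT cK.
pose P A := exists a f, (forall s, finite_set (f s)) /\ A `<=` fan a f.
apply: (compact_induction (P := P)) => //.
- by exists v0, (fun=> set0); split.
- by move=> A C AC [a [f [finf Cf]]]; exists a, f; split=> //; exact: subset_trans Cf.
- move=> A C [a [f [finf Af]]] [c [g [fing Cg]]].
  have [b bP] := bounded (fun n => if n is 0%N then a else c).
  exists b, (fun s => f s `|` g s); split.
    by move=> s; rewrite finite_setU; split.
  rewrite subUset; split.
  + apply: subset_trans Af _; apply: fanS => [b' b'a|s t]; last by left.
    exact: tr b'a (bP 0%N).
  + apply: subset_trans Cg _; apply: fanS => [b' b'c|s t]; last by right.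
    exact: tr b'c (bP 1%N).
move=> x C Kx CK h.
have /choice[a aP] (n : nat) : exists a, exists f, (forall s, finite_set (f s)) /\
    C `&` [set y | n.+1%:R^-1 <= d x y] `<=` fan a f.
  by apply: h; rewrite invr_gt0.
have {aP}/choice[f fP] := aP.
have [c cP] := bounded a.
(* The new fan has center [x]; its branch [n] covers the part of [C] at distance at least
   [1 / (n + 1)], and its index [a n] is added at the root of [f n]. *)
pose g s := if s is n :: s'
  then f n s' `|` (if s' is [::] then [set val (a n)] else set0)
  else [set j x].
exists c, g; split=> [[|n s]|y Cy] /=; first exact: finite_set1.
  rewrite finite_setU; split; first by have [] := fP n.
  by case: s => [|? ?]; [exact: finite_set1|exact: finite_set0].
have [->|/annulus[n yn ny]] := pselect (y = x); first exact: fan_center.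
apply: (@fan_branch c g x n (a n)) => //=; first by right.
have [_ /(_ y (conj Cy ny))] := fP n.
by apply: fanS => // s t; left.
Qed.

End tukey.

(** A sequence of finite sets is read as a code by numbering the finite sequences of naturals. The
    index of the fan must come from the sequence too, so [phi g] unites the fans for all indices
    listed at the root. *)
Lemma cof_compacts_le (kappa : Type) : totally_imperfect T ->
  [set: T] #<= [set: kappa] -> ~ countable [set: kappa] ->
  cof_compacts T #<= cof_finsets_omega kappa.
Proof.
move=> tiT /card_leTP[j jinj] nck.
have [V [lt [wf tr nVS tot seg]]] := exists_initial_order nck.
have bounded (s : nat -> V) : exists a, forall i, lt (s i) a.
  exact: initial_order_bounded infinite_nat (card_lexx _) nVS tot seg.
have [v0 _] : exists v0 : V, True.
  apply: contrapT => nv; apply: nVS; apply/card_leTP.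
  by exists (fun=> 0%N) => v; case: nv; exists v.
have finP (f : set_type [set A : set kappa | finite_set A]) : finite_set (val f).
  exact: (set_valP f).
pose phi (g : nat -> set_type [set A : set kappa | finite_set A]) :=
  \bigcup_(a in [set a : V | val (g (choice.pickle ([::] : seq nat))) (val a)])
  fan j lt a (fun s => val (g (choice.pickle s))).
have cphi g : compact (phi g).
  apply: compact_bigcup_finite => [|a _].
    by apply: finite_preimage (finP _); apply: in2W; exact: val_inj.
  by apply: compact_fans.
apply: (cof_surj (phi := fun g =>
  SigSub (mem_set (cphi g : [set K | compact K] _)))) => [K x //|K].
have [a [f [finf Kf]]] := fan_cofinal j v0 tr bounded tiT (set_valP K).
(* Storing [a] in the code makes every larger [g'] list it at the root. *)
pose f' s := f s `|` [set val a].
have finf' s : finite_set (f' s) by rewrite finite_setU; split=> //; exact: finite_set1.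
have fin0 : [set A : set kappa | finite_set A] set0 by exact: finite_set0.
pose g n : set_type [set A : set kappa | finite_set A] :=
  if choice.unpickle n is Some s
  then SigSub (mem_set (finf' s : [set A : set kappa | finite_set A] _))
  else SigSub (mem_set fin0).
have [g' Dg gg'] := (cofP
  (le := pointwise (@Defs.incl kappa [set A | finite_set A]))
  (fun f n t ft => ft)).1 g.
exists g' => // y /Kf fy.
have fg' s : f' s `<=` val (g' (choice.pickle s)).
  by have := gg' (choice.pickle s); rewrite /Defs.incl /g choice.pickleK.
exists a; first by apply: fg'; right.
by apply: fanS fy => // s t ft; apply: fg'; left.
Qed.

End metric.

Theorem corollary16 (R : realType) (B : topologicalType) :
  metrizable R B -> separable B -> totally_imperfect B -> ~ scattered B ->
  let kappa := card_max (aleph 1) B in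
  ([set: card_max dominating_number B] #<= cof_compacts B /\
   cof_compacts B #<= cof_finsets_omega kappa) /\
  (forall n : nat, [set: kappa] #= [set: aleph n] ->
     cof_compacts B #= [set: card_max dominating_number B]).
Proof.
move=> [d [dxx d0 dC dtri nbhsd]] sB tiB nscB kappa.
have [cofC _] := cofP (le := @Defs.incl B [set K | compact K]) (fun K x => id).
have dom_inf : ~ countable dominating_number.
  by apply: not_countable_dominating; apply: (cofP _).1 => f i; exact: leqnn.
have aleph1_dom : [set: aleph 1] #<= dominating_number.
  rewrite -(card_le_eqr (card_setT _)); apply: succ_card_le.
  by rewrite (card_le_eql (card_setT _)).
have dC_le := dominating_le_compacts dxx d0 dC dtri nbhsd sB tiB nscB cofC.
have lower : [set: card_max dominating_number B] #<= cof_compacts B.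
  rewrite -(card_le_eqr (card_setT _)); apply: card_maxP.
    by rewrite (card_le_eql (card_setT _)) (card_le_eqr (card_setT _)).
  have natC : [set: nat] #<= [set: cof_compacts B].
    rewrite (card_le_eqr (card_setT _)); apply: card_le_trans dC_le.
    by apply: card_le_trans aleph1_dom; exact/infiniteP/infinite_aleph.
  (* The countable factor is absorbed, as the cofinality is infinite. *)
  apply: card_le_trans (card_le_compacts dxx d0 dC dtri nbhsd tiB cofC) _.
  apply: card_le_trans (card_le_square _); last exact/infiniteP.
  by apply: card_leX => //; exact: card_lexx.
have nck (K : Type) : [set: kappa] #<= [set: K] -> ~ countable [set: K].
  move=> kK cK; apply: (@not_card_succ_le nat).
  apply: card_le_trans (card_le_maxl (aleph 1) B) _.
  exact: card_le_trans kK cK.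
(* [K] is left general since the second claim takes [aleph n] for it, which is only equipotent with
   [kappa]. *)
have upper (K : Type) : [set: kappa] #<= [set: K] ->
    cof_compacts B #<= cof_finsets_omega K.
  move=> kK; apply: (cof_compacts_le dxx d0 dC dtri nbhsd tiB) (nck _ kK).
  by apply: card_le_trans kK; exact: card_le_maxr.
split; first by split=> //; apply: upper; exact: card_lexx.
move=> n; rewrite card_eq_le => /andP[kn nk]; rewrite card_eq_le lower andbT.
apply: card_le_trans (upper _ kn) _.
apply: card_le_trans (cof_finsets_omega_aleph n) _.
set M := card_max dominating_number B.
have domM : [set: dominating_number] #<= [set: M] by exact: card_le_maxl.
have aleph1M : [set: aleph 1] #<= [set: M].
  by apply: card_le_trans domM; rewrite (card_le_eqr (card_setT _)).
(* Both factors are at most the infinite cardinal [M]: [aleph n] is at most [kappa], and [aleph 1]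
   and [B] are at most [M]. *)
apply: card_le_trans (card_le_square _).
  apply: card_leX domM; apply: card_le_trans nk _.
  by apply: card_maxP => //; exact: card_le_maxr.
by apply/infiniteP; apply: card_le_trans aleph1M; exact/infiniteP/infinite_aleph.
Qed.
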